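(* Let $F$ be a social choice set and let $\mathcal{S}=(R,E)$ be a solution concept. Let $\Gamma^F$ be the class of all mechanisms that fully implement $F$ in $\mathcal{S}$. (i) If $F$ is fully implementable in $\mathcal{S}$ and $\mathcal{S}$ satisfies Total Weak Solution Consistency (TWSC), then $F$ is Bayesian Incentive Compatible (BIC). (ii) If $F$ is fully implementable in $\mathcal{S}$ and BIC, then $\mathcal{S}$ is TWSC for every mechanism in $\Gamma^F$.
   Context: Environment. $I$ is the set of agents, $A$ the set of alternatives, $T_i$ the set of types of agent $i$, $T=\times_{i\in I}T_i$, $T_{-i}=\times_{j\neq i}T_j$. The spaces $A$, $T_i$ and all action sets $S_i$ below are separable metrizable with Borel $\sigma$-algebras, and products carry the product topology. Type $t_i$ of agent $i$ has a belief $p_i(\cdot|t_i)\in\Delta(T_{-i})$ with full support. Bernoulli utilities $u_i:A\times T\to\mathbb{R}$ are bounded and continuous; for a lottery $a\in\Delta(A)$, $u_i(a,t)$ denotes expected utility. Social choice and mechanisms. A social choice function (SCF) is a measurable $f:T\to\Delta(A)$; a social choice set is a nonempty set $F$ of SCFs. A mechanism is a pair $\gamma=(\mu,S)$ with $S=\times_{i\in I}S_i$ and $\mu:S\to\Delta(A)$ measurable; $\Gamma$ is the class of all mechanisms. Given $\gamma$, $\Sigma$ is the set of strategy profiles, i.e. measurable $\sigma:T\to\Delta(S)$; $\Sigma_{-i}$ is the set of measurable $\sigma_{-i}:T_{-i}\to\Delta(S_{-i})$. For $\sigma\in\Sigma$, the notation $(\sigma_i(t_i'),\sigma_{-i}(t_{-i}))$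 stands for $\sigma(t_i',t_{-i})$. $\mu(\sigma(t))\in\Delta(A)$ is the lottery induced by $\sigma(t)$ under $\mu$, and $\mu(\sigma)$ is the SCF $t\mapsto\mu(\sigma(t))$. Solution concepts. An expectation profile for $\gamma$ is $e=(e_i)_{i\in I}$ with $e_i:T_i\to\Sigma_{-i}$, $t_i\mapsto e_{i,t_i}$. A theory of expectations $E$ assigns to each mechanism $\gamma$ a set $E(\gamma)$ of expectation profiles for $\gamma$. A theory of response $R$ assigns to each mechanism $\gamma$ and each $e\in E(\gamma)$ a set $R(e)\subseteq\Sigma$. A solution concept is a pair $\mathcal{S}=(R,E)$; its set of solutions to $\gamma$ is $\mathcal{S}(\gamma)=\bigcup_{e\in E(\gamma)}R(e)$. Full implementation. A mechanism $\gamma=(\mu,S)$ fully implements $F$ in $\mathcal{S}$ if $\{\mu(\sigma):\sigma\in\mathcal{S}(\gamma)\}=F$ and $R(e)\neq\emptyset$ for all $e\in E(\gamma)$. $F$ is fully implementable in $\mathcal{S}$ if $\Gamma^F\neq\emptyset$. BIC. An SCF $f$ is BIC if for all $i\in I$ and $t_i,t_i'\in T_i$, $\int_{T_{-i}}u_i(f(t),t)\,dp_i(t_{-i}|t_i)\geq\int_{T_{-i}}u_i(f(t_i',t_{-i}),t)\,dp_i(t_{-i}|t_i)$, where $t=(t_i,t_{-i})$. $F$ is BIC if every $f\in F$ is BIC. TWSC. $\mathcal{S}$ is TWSC for mechanism $\gamma=(\mu,S)$ if for all $\sigma\in\mathcal{S}(\gamma)$, $i\in I$, $t_i,t_i'\in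 T_i$: $\int_{T_{-i}}u_i(\mu(\sigma(t)),t)\,dp_i(t_{-i}|t_i)\geq\int_{T_{-i}}u_i(\mu(\sigma_i(t_i'),\sigma_{-i}(t_{-i})),t)\,dp_i(t_{-i}|t_i)$. $\mathcal{S}$ is TWSC if it is TWSC for all $\gamma\in\Gamma$ with $\mathcal{S}(\gamma)\neq\emptyset$. *)

(* Defs.v *)
From HB Require Import structures.
From mathcomp Require Import all_boot all_order all_algebra.
From mathcomp Require Import all_classical all_reals all_analysis.
From mathcomp Require Import measurable_realfun.
Import Order.TTheory GRing.Theory Num.Theory numFieldNormedType.Exports.

Set Implicit Arguments.
Unset Strict Implicit.
Unset Printing Implicit Defensive.

Local Open Scope classical_set_scope.
Local Open Scope ring_scope.

Definition separable (X : topologicalType) : Prop :=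
  exists2 D : set X, countable D & dense D.

Definition metrizable (R : realType) (X : topologicalType) : Prop :=
  exists d : X -> X -> R,
    [/\ forall x, d x x = 0,
        forall x y, d x y = 0 -> x = y,
        forall x y, d x y = d y x,
        forall x y z, d x z <= d x y + d y z &
        forall (x : X) (B : set X),
          nbhs x B <-> exists2 e : R, 0 < e & [set y | d x y < e] `<=` B].

(* Measurable types of the library are pointed, hence the restriction to
   nonempty spaces. *)
Definition borel (X : ptopologicalType) : measurableType (@open X).-sigma :=
  g_sigma_algebraType (@open X).

(* The sigma-algebra on [Delta R X] is generated by the evaluation maps
   P |-> P B, B Borel; for X separable metrizable it is the Borel
   sigma-algebra of the weak topology. *)
Definition Delta (R : realType) (X : ptopologicalType) :=
  pprobability (borel X) R.

Definition full_support (R : realType) (X : ptopologicalType) (P : Delta R X) :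
    Prop :=
  forall U : set X, open U -> U !=set0 -> (0%E < P U)%E.

(* Library measures are functions on all sets, with unspecified values off the
   sigma-algebra, so equality of measure-valued maps is stated on measurable
   sets only. *)
Definition eq_lottery (R : realType) (X Y : ptopologicalType)
    (f g : {mfun borel X >-> Delta R Y}) : Prop :=
  forall (x : X) (B : set (borel Y)), measurable B -> f x B = g x B.

Section Mix.
Context (R : realType) (X Y Z : ptopologicalType).
Variables (k : {mfun borel Y >-> Delta R Z}).

(* The lottery over Z obtained by drawing y from nu and then z from k y. *)
Definition mix (nu : Delta R Y) (B : set (borel Z)) : \bar R :=
  (\int[nu]_y k y B)%E.

Section MixMeasure.
Variable nu : Delta R Y.

Let cst_kernel := kprobability
  (measurable_cst nu : measurable_fun [set: borel Y] (fun=> nu)).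
Let k_kernel := kprobability (measurable_funPT k).

Let mix0 : mix nu set0 = 0%E.
Proof. exact: (measure0 (mkcomp_noparam cst_kernel k_kernel point)). Qed.

Let mix_ge0 B : (0 <= mix nu B)%E.
Proof. exact: (measure_ge0 (mkcomp_noparam cst_kernel k_kernel point)). Qed.

Let mix_semi_sigma_additive : semi_sigma_additive (mix nu).
Proof.
exact: (@measure_semi_sigma_additive _ _ _
  (mkcomp_noparam cst_kernel k_kernel point)).
Qed.

HB.instance Definition _ := isMeasure.Build _ _ _ (mix nu)
  mix0 mix_ge0 mix_semi_sigma_additive.

Let mix_setT : mix nu setT = 1%E.
Proof.
rewrite /mix (eq_integral (cst 1%E)); last first.
  by move=> y _; exact: (probability_setT (k y)).
by rewrite integral_cst// mul1e; exact: (probability_setT nu).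
Qed.

HB.instance Definition _ := Measure_isProbability.Build _ _ _ (mix nu) mix_setT.

Definition pmix : Delta R Z := mix nu.
End MixMeasure.

Variable s : {mfun borel X >-> Delta R Y}.

Definition comp_kernel (x : borel X) : Delta R Z := pmix (s x).

Lemma measurable_comp_kernel : measurable_fun [set: borel X] comp_kernel.
Proof.
apply: (measurability (@pset _ _ _ : set (set (Delta R Z)))) => //.
move=> _ -[_ [r r01] [B mB <-]] <-.
apply: emeasurable_fun_infty_o => //.
exact: (@measurable_kernel _ _ _ _ _
  (mkcomp_noparam (kprobability (measurable_funPT s))
                  (kprobability (measurable_funPT k))) B mB).
Qed.

HB.instance Definition _ :=
  isMeasurableFun.Build _ _ _ _ comp_kernel measurable_comp_kernel.

Definition mcomp : {mfun borel X >-> Delta R Z} := comp_kernel.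
End Mix.

Definition others (I : Type) (i : I) : Type := {j : I | j <> i}.

HB.instance Definition _ (I : Type) (X : I -> ptopologicalType) :=
  isPointed.Build (prod_topology X) (fun=> point).

Definition prod_all (I : Type) (X : I -> ptopologicalType) : ptopologicalType :=
  prod_topology X.

Definition prod_others (I : Type) (X : I -> ptopologicalType) (i : I) :
    ptopologicalType :=
  prod_topology (fun j : others i => X (sval j)).

Definition combine (I : Type) (X : I -> ptopologicalType) (i : I)
    (x : X i) (y : prod_others X i) : prod_all X :=
  fun j => match pselect (j = i) with
           | left e => ecast k (X k) (esym e) x
           | right ne => y (exist _ j ne)
           end.

Record environment (R : realType) := Environment {
  agent : Type ;
  alt : ptopologicalType ;
  types : agent -> ptopologicalType ;
  belief : forall i : agent, types i -> Delta R (prod_others types i) ;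
  utility : agent -> (alt * prod_all types)%type -> R ;
  alt_separable : separable alt ;
  alt_metrizable : metrizable R alt ;
  types_separable : forall i, separable (types i) ;
  types_metrizable : forall i, metrizable R (types i) ;
  belief_full_support : forall i (ti : types i), full_support (belief ti) ;
  utility_bounded : forall i, [bounded utility i x | x in setT] ;
  utility_continuous : forall i, continuous (utility i) }.

Section Implementation.
Context (R : realType) (env : environment R).

Local Notation I := (agent env).
Local Notation A := (alt env).
Local Notation T := (@types R env).

Definition eutility (i : I) (a : Delta R A) (t : prod_all T) : R :=
  (\int[a]_x utility i (x, t))%R.

Definition SCF := {mfun borel (prod_all T) >-> Delta R A}.

Definition BIC (f : SCF) : Prop :=
  forall (i : I) (ti ti' : T i),
    (\int[belief ti]_tmi eutility i (f (combine ti' tmi)) (combine ti tmi))%R <=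
    (\int[belief ti]_tmi eutility i (f (combine ti tmi)) (combine ti tmi))%R.

Definition set_BIC (F : set SCF) : Prop := forall f, F f -> BIC f.

Record mechanism := Mechanism {
  action : I -> ptopologicalType ;
  outcome : {mfun borel (prod_all action) >-> Delta R A} ;
  action_separable : forall i, separable (action i) ;
  action_metrizable : forall i, metrizable R (action i) }.

Definition strategy (g : mechanism) :=
  {mfun borel (prod_all T) >-> Delta R (prod_all (action g))}.

Definition strategy_others (g : mechanism) (i : I) :=
  {mfun borel (prod_others T i) >-> Delta R (prod_others (action g) i)}.

Definition expectation (g : mechanism) :=
  forall i : I, T i -> strategy_others g i.

Definition induced_scf (g : mechanism) (s : strategy g) : SCF :=
  mcomp (outcome g) s.

Record solution_concept := SolutionConcept {
  expects : forall g : mechanism, set (expectation g) ;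
  responds : forall (g : mechanism) (e : expectation g),
    expects e -> set (strategy g) }.

Definition solutions (S : solution_concept) (g : mechanism) :
    set (strategy g) :=
  [set s | exists (e : expectation g) (he : expects S e), responds he s].
Arguments solutions : clear implicits.

(* The first two clauses say that the SCFs induced by the solutions to g are
   exactly those in F. *)
Definition fully_implements (S : solution_concept) (F : set SCF)
    (g : mechanism) : Prop :=
  [/\ forall s, solutions S g s -> exists2 f, F f & eq_lottery f (induced_scf s),
      forall f, F f -> exists2 s, solutions S g s & eq_lottery f (induced_scf s) &
      forall (e : expectation g) (he : expects S e), responds he !=set0].

Definition fully_implementable (S : solution_concept) (F : set SCF) : Prop :=
  exists g : mechanism, fully_implements S F g.

Definition TWSC_for (S : solution_concept) (g : mechanism) : Prop :=
  forall s, solutions S g s -> forall (i : I) (ti ti' : T i),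
    (\int[belief ti]_tmi
       eutility i (pmix (outcome g) (s (combine ti' tmi))) (combine ti tmi))%R <=
    (\int[belief ti]_tmi
       eutility i (pmix (outcome g) (s (combine ti tmi))) (combine ti tmi))%R.

Definition TWSC (S : solution_concept) : Prop :=
  forall g : mechanism, solutions S g !=set0 -> TWSC_for S g.

End Implementation.

(* Main.v *)
Require Import Defs.
From mathcomp Require Import all_boot all_order all_algebra.
From mathcomp Require Import all_classical all_reals all_analysis.

Set Implicit Arguments.
Unset Strict Implicit.
Unset Printing Implicit Defensive.

Local Open Scope classical_set_scope.

(** The SCFs in F are exactly those induced by the solutions to an implementing
    mechanism, and for the SCF t |-> mu(sigma(t)) the BIC inequalities are
    literally the TWSC inequalities at sigma. *)

(** An integral depends on the measure only through its values on measurable sets. *)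
Lemma eq_eutility (R : realType) (env : environment R) (i : agent env)
    (a b : Delta R (alt env)) :
  (forall B : set (borel (alt env)), measurable B -> a B = b B) ->
  eutility i a = eutility i b.
Proof.
move=> eq_ab; apply/funext => t; rewrite /eutility /Rintegral.
by congr fine; apply: eq_measure_integral => B mB _; exact: eq_ab.
Qed.

(** Full implementation matches SCFs only up to [eq_lottery], so BIC has to be carried across that
    relation. *)
Lemma eq_lottery_BIC (R : realType) (env : environment R) (f h : SCF env) :
  eq_lottery f h -> BIC f <-> BIC h.
Proof.
move=> eq_fh.
(* One identity serves both sides of BIC: [ti' := ti] is the truthful case. *)
have eq_int i (ti ti' : types i) :
    (\int[belief ti]_tmi eutility i (f (combine ti' tmi)) (combine ti tmi))%R =
    (\int[belief ti]_tmi eutility i (h (combine ti' tmi)) (combine ti tmi))%R.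
  apply: eq_Rintegral => tmi _.
  exact: (congr1 (@^~ _) (eq_eutility i (eq_fh _))).
by split=> bic i ti ti'; have := bic i ti ti';
  rewrite (eq_int i ti ti) (eq_int i ti ti').
Qed.

(** Holds by conversion: [induced_scf s] at [t] unfolds to [pmix (outcome g) (s t)]. *)
Lemma TWSC_forP (R : realType) (env : environment R) (S : solution_concept env)
    (g : mechanism env) :
  TWSC_for S g <-> forall s : strategy g, solutions S s -> BIC (induced_scf s).
Proof. split; exact id. Qed.

Theorem theorem4 (R : realType) (env : environment R) (F : set (SCF env))
    (F_neq0 : F !=set0) (S : solution_concept env) :
  (fully_implementable S F -> TWSC S -> set_BIC F) /\
  (fully_implementable S F -> set_BIC F ->
     forall g : mechanism env, fully_implements S F g -> TWSC_for S g).
Proof.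
split=> [[g [_ F_sol _]] twsc f Ff | _ bicF g [sol_F _ _]].
  have [s sol_s fs] := F_sol f Ff.
  apply/(eq_lottery_BIC fs).
  (* The solution [s] that induces [f] also witnesses [solutions S g !=set0], as [TWSC] demands. *)
  by move/TWSC_forP: (twsc g (ex_intro _ s sol_s)); exact.
apply/TWSC_forP => s sol_s.
have [f Ff fs] := sol_F s sol_s.
exact: (eq_lottery_BIC fs).1 (bicF f Ff).
Qed.
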